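(* Suppose that the following statement (the Cross--product conjecture) holds: for every finite poset $Q=(Y,\prec)$, every three distinct elements $x,y,z\in Y$ and all integers $a,b\ge 1$, \[ \mathrm{F}_{xyz}(Q,a+1,b)\cdot \mathrm{F}_{xyz}(Q,a,b+1)\ \ge\ \mathrm{F}_{xyz}(Q,a,b)\cdot \mathrm{F}_{xyz}(Q,a+1,b+1). \] Then for every finite poset $P=(X,\prec)$, every element $z\in X$ and all integers $a,i\ge 1$, \[ (a+i-1)\,\mathrm{N}(P,z,a+i-1)\cdot \mathrm{N}(P,z,a)\ \ge\ (a-1)\,\mathrm{N}(P,z,a-1)\cdot \mathrm{N}(P,z,a+i)\ +\ i\,\mathrm{N}(P,z,a+i)\cdot \mathrm{N}(P,z,a). \]
   Context: For a finite poset $P=(X,\prec)$ with $|X|=n$, a linear extension is a bijection $f:X\to[n]$ with $f(u)<f(v)$ whenever $u\prec v$; $\mathcal{E}(P)$ is the set of linear extensions. For $z\in X$ and an integer $c$, $\mathrm{N}(P,z,c)$ denotes the number of $f\in\mathcal{E}(P)$ with $f(z)=c$ (so it is $0$ if $c\notin[n]$). For distinct $x,y,z$ and integers $a,b$, $\mathrm{F}_{xyz}(P,a,b)$ denotes the number of $f\in\mathcal{E}(P)$ with $f(y)-f(x)=a$ and $f(z)-f(y)=b$. *)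

(* Defs.v *)
From mathcomp Require Import all_boot all_order all_algebra.

Set Implicit Arguments.
Unset Strict Implicit.
Unset Printing Implicit Defensive.

Import Order.TTheory GRing.Theory Num.Theory.
Local Open Scope ring_scope.

Section LinearExtensions.

Variables (d : Order.disp_t) (P : finPOrderType d).
Implicit Types (f : {ffun P -> 'I_#|P|}) (u v x y z : P).

(* 'I_n is {0, .., n - 1}, so the shift by one makes the labels run over
   [n] = {1, .., n}. *)
Definition label f x : int := (f x).+1%:Z.

Definition linear_extension f : bool :=
  [&& injectiveb f,
      [forall k, exists x, f x == k]
    & [forall u, forall v, (u < v)%O ==> (label f u < label f v)]].

Definition linear_extensions : {set {ffun P -> 'I_#|P|}} :=
  [set f | linear_extension f].

Definition Nle z (c : int) : nat :=
  #|[set f in linear_extensions | label f z == c]|.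

Definition Fle x y z (a b : int) : nat :=
  #|[set f in linear_extensions |
      (label f y - label f x == a) && (label f z - label f y == b)]|.

End LinearExtensions.

Definition cross_product_conjecture : Prop :=
  forall (d : Order.disp_t) (Q : finPOrderType d) (x y z : Q),
    x != y -> y != z -> x != z ->
  forall a b : int, 1 <= a -> 1 <= b ->
    (Fle x y z a b * Fle x y z (a + 1) (b + 1)
       <= Fle x y z (a + 1) b * Fle x y z a (b + 1))%N.

(* Main.v *)
(** Let N(c) = N(P, z, c), let P' be P together with an isolated element u, and
    let N'(c) = N(P', z, c) = (c - 1) N(c - 1) + (n + 1 - c) N(c). The claimed
    inequality says exactly that N'(a) N(a + i) <= N'(a + i) N(a), i.e. that the
    ratio N'(c) / N(c) is nondecreasing.

    For i = 1 this is one instance of the cross-product inequality. Adjoin to P'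
    an element y below P but incomparable to u, and then a bottom element x. If
    f(y) - f(x) = 1, deleting x and y leaves an arbitrary linear extension of P';
    if f(y) - f(x) = 2, then u lies between x and y, and deleting all three
    leaves a linear extension of P. Hence F(1, b) = N'(b) and F(2, b) = N(b).

    Steps i = 1 can be chained because the support of N has no gaps: passing from
    P to P' shortens a gap by one, and a gap of length one contradicts the case
    i = 1. *)

Require Import Defs.
From HB Require Import structures.
From mathcomp Require Import all_boot all_order all_algebra.
From mathcomp Require Import zify.

Import Order.TTheory GRing.Theory Num.Theory.
Local Open Scope ring_scope.

Set Implicit Arguments.
Unset Strict Implicit.
Unset Printing Implicit Defensive.

Lemma subz_succ_eq (p q a : nat) :
  (q.+1%:Z - p.+1%:Z == a%:Z) = (q == p + a)%N.
Proof. by lia. Qed.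

(** * Injective labellings of a type with one extra point *)

Section Insertion.

Local Open Scope nat_scope.
Variables (T : finType) (n : nat).

(** [lift k] is the increasing embedding that skips [k], so the old labels keep their relative
    order. *)
Definition insert (k : 'I_n.+1) (g : {ffun T -> 'I_n}) :
    {ffun option T -> 'I_n.+1} :=
  [ffun o => if o is Some t then lift k (g t) else k].

Lemma insert_inj k : injective (insert k).
Proof.
move=> g h /ffunP eq_gh; apply/ffunP => t.
by have := eq_gh (Some t); rewrite !ffunE => /lift_inj.
Qed.

Lemma injectiveb_insert k g : injectiveb (insert k g) = injectiveb g.
Proof.
apply/injectiveP/injectiveP => [inj_f t u eq_g | inj_g [t|] [u|]].
- suff [//] : Some t = Some u by [].
  by apply: inj_f; rewrite !ffunE eq_g.
- by rewrite !ffunE => /lift_inj /inj_g ->.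
- by rewrite !ffunE => /esym/eqP; rewrite (negPf (neq_lift _ _)).
- by rewrite !ffunE => /eqP; rewrite (negPf (neq_lift _ _)).
- by [].
Qed.

Lemma injective_is_insert (f : {ffun option T -> 'I_n.+1}) :
  injective f -> exists g, f = insert (f None) g.
Proof.
move=> inj_f.
have /fin_all_exists [g fE] t : exists j, f (Some t) = lift (f None) j.
  have /unlift_some [j fE _] : f None != f (Some t).
    by apply/eqP => /inj_f.
  by exists j.
by exists (finfun g); apply/ffunP => -[t|]; rewrite !ffunE.
Qed.

Lemma card_injective_option (A : pred {ffun option T -> 'I_n.+1}) :
  #|[set f : {ffun option T -> 'I_n.+1} | injectiveb f && A f]| =
  \sum_(k < n.+1) #|[set g : {ffun T -> 'I_n} | injectiveb g && A (insert k g)]|.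
Proof.
rewrite -sum1_card.
rewrite (partition_big (fun f : {ffun option T -> 'I_n.+1} => f None) xpredT) //=.
apply: eq_bigr => k _; rewrite sum1_card -(card_imset _ (@insert_inj k)).
apply: eq_card => f; apply/idP/imsetP => [|[g]].
  rewrite unfold_in inE => /andP[/andP[/injectiveP inj_f Af] /eqP fk].
  have [g fE] := injective_is_insert inj_f; rewrite fk in fE.
  by exists g => //; rewrite inE -fE Af -(injectiveb_insert k) -fE andbT;
    apply/injectiveP.
rewrite inE => /andP[inj_g Ag] ->.
by rewrite unfold_in inE injectiveb_insert inj_g Ag ffunE eqxx.
Qed.

End Insertion.

(** * Linear extensions with zero-based labels *)

Section ParametricLinearExtensions.

Local Open Scope nat_scope.
Variables (d : Order.disp_t) (P : finPOrderType d).

Definition monotone n (f : {ffun P -> 'I_n}) :=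
  [forall u, forall v, (u < v)%O ==> (f u < f v)].

(* The codomain size is a free parameter, so that no cast is needed when an
   element is adjoined to P. *)
Definition lexts n : {set {ffun P -> 'I_n}} :=
  [set f : {ffun P -> 'I_n} | injectiveb f && monotone f].

Lemma lexts_surj n (f : {ffun P -> 'I_n}) (k : 'I_n) :
  n = #|P| -> f \in lexts n -> exists t, f t = k.
Proof.
move=> nE; rewrite inE => /andP[/injectiveP inj_f _].
have : k \in codom f by apply: inj_card_onto; rewrite // card_ord nE.
by case/codomP => t ->; exists t.
Qed.

Lemma lexts_linear : lexts #|P| = linear_extensions P.
Proof.
apply/setP => f; rewrite !inE /linear_extension.
case inj_f: (injectiveb f) => //=.
have -> : [forall k, exists x, f x == k].
  apply/forallP => k; apply/existsP.
  have /codomP [t ->] : k \in codom f.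
    by apply: inj_card_onto; [apply/injectiveP | rewrite card_ord].
  by exists t.
by apply: eq_forallb => u; apply: eq_forallb => v; rewrite /label.
Qed.

Lemma NleE n z (c : nat) : n = #|P| ->
  Nle z c = #|[set f in lexts n | (f z).+1 == c]|.
Proof.
move=> ->; rewrite /Nle lexts_linear; apply: eq_card => f.
by rewrite !inE; congr (_ && _); rewrite /label; lia.
Qed.

Lemma FleE n x y z (a b : nat) : n = #|P| ->
  Fle x y z a b =
  #|[set f in lexts n | (f y == f x + a :> nat) && (f z == f y + b :> nat)]|.
Proof.
move=> ->; rewrite /Fle lexts_linear; apply: eq_card => f.
by rewrite !inE /label !subz_succ_eq.
Qed.

Lemma Nle0 (z : P) : Nle z 0 = 0.
Proof.
by apply/eqP; rewrite cards_eq0; apply/eqP/setP => f; rewrite !inE andbC.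
Qed.

Lemma Nle_gt0_bound (z : P) (c : nat) : 0 < Nle z c -> 0 < c <= #|P|.
Proof.
rewrite (NleE _ _ erefl) => /card_gt0P [f]; rewrite inE => /andP[_ /eqP <-].
by rewrite ltn_ord.
Qed.

End ParametricLinearExtensions.

(** * Linear extensions after adjoining an element *)

Section Adjoin.

Local Open Scope nat_scope.
Variables (d : Order.disp_t) (P : finPOrderType d).

Definition upclosed (U : pred P) := forall u v, (u < v)%O -> U u -> U v.

(* P with one new element None, lying below the elements of U and
   incomparable to all others. *)
Definition adjoin (U : pred P) of upclosed U : Type := option P.

Variables (U : pred P) (upU : upclosed U).

HB.instance Definition _ := Finite.on (adjoin upU).

Definition adjoin_lt : rel (adjoin upU) := fun s t =>
  match s, t with
  | Some u, Some v => (u < v)%O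
  | None, Some v => U v
  | _, None => false
  end.

Lemma adjoin_lt_irr : irreflexive adjoin_lt.
Proof. by case=> //= u; rewrite ltxx. Qed.

Lemma adjoin_lt_trans : transitive adjoin_lt.
Proof.
move=> [v|] [u|] [w|] //=; first exact: lt_trans.
by move=> Uv /upU; apply.
Qed.

HB.instance Definition _ :=
  Order.Lt_isPOrder.Build d (adjoin upU) adjoin_lt_irr adjoin_lt_trans.

Lemma card_adjoin : #|adjoin upU : finType| = #|P|.+1.
Proof. exact: card_option. Qed.

(** The bound is weak because [lift k] raises [g t] above [k] exactly when [k <= g t]. *)
Lemma monotone_insert n (k : 'I_n.+1) (g : {ffun P -> 'I_n}) :
  monotone (insert k g : {ffun adjoin upU -> 'I_n.+1}) =
  monotone g && [forall t, U t ==> (k <= g t)].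
Proof.
apply/forallP/andP => [mono_f | [/forallP mono_g /forallP kU]].
  split; apply/forallP => u.
    apply/forallP => v; have /forallP/(_ (Some v)) := mono_f (Some u).
    by rewrite !ffunE /= !ltnNge leq_bump2.
  have /forallP/(_ (Some u)) := mono_f None.
  by rewrite !ffunE /= ltnNge /bump; move/implyP => H; apply/implyP => /H; lia.
move=> s; apply/forallP => t; apply/implyP.
case: s t => [u|] [v|] //; rewrite !ffunE /=.
  move=> lt_uv; have /forallP/(_ v)/implyP/(_ lt_uv) := mono_g u.
  by rewrite !ltnNge leq_bump2.
by move=> Uv; have /implyP/(_ Uv) := kU v; rewrite /bump; lia.
Qed.

Lemma card_lexts_adjoin n (A : pred {ffun adjoin upU -> 'I_n.+1}) :
  #|[set f in lexts (adjoin upU) n.+1 | A f]| =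
  \sum_(k < n.+1)
    #|[set g in lexts P n | [forall t, U t ==> (k <= g t)] && A (insert k g)]|.
Proof.
transitivity #|[set f : {ffun option P -> 'I_n.+1} | injectiveb f &&
    (monotone (f : {ffun adjoin upU -> 'I_n.+1}) && A f)]|.
  by apply: eq_card => f; rewrite !inE -andbA.
rewrite card_injective_option; apply: eq_bigr => k _.
by apply: eq_card => g; rewrite !inE monotone_insert -!andbA.
Qed.

Lemma card_lexts_adjoin_bottom n (A : pred {ffun adjoin upU -> 'I_n.+1}) :
  n = #|P| -> (forall t, U t) ->
  #|[set f in lexts (adjoin upU) n.+1 | A f]| =
  #|[set g in lexts P n | A (insert ord0 g)]|.
Proof.
move=> nE U_all; rewrite card_lexts_adjoin (bigD1 ord0) //= big1 ?addn0.
  apply: eq_card => g; rewrite !inE.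
  rewrite (_ : [forall t, _] = true) //.
  by apply/forallP => t; apply/implyP.
(* For [k > 0] the old element labelled 0 would stay below the new bottom. *)
move=> k; rewrite -val_eqE /= => k_neq0.
apply/eqP; rewrite cards_eq0; apply/eqP/setP => g; rewrite in_set0.
apply/negP => /setIdP[g_lext /andP[/forallP k_le _]].
have n_gt0 : 0 < n by have := ltn_ord k; lia.
have [t gt] := lexts_surj (Ordinal n_gt0) nE g_lext.
by have := k_le t; rewrite U_all gt /=; lia.
Qed.

End Adjoin.

(** * The recurrence for an isolated element *)

Section Isolated.

Local Open Scope nat_scope.
Variables (d : Order.disp_t) (P : finPOrderType d).

Lemma upclosed0 : upclosed (pred0 : pred P).
Proof. by []. Qed.

Lemma upclosedT : upclosed (predT : pred P).
Proof. by []. Qed.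

Definition isolated : finPOrderType d := adjoin upclosed0.

Lemma card_isolated : #|isolated| = #|P|.+1.
Proof. exact: card_adjoin. Qed.

(** The position [k = c - 1] counts zero: it is the one that z itself must occupy. *)
Lemma sum_insert_positions m c X Y :
  \sum_(k < m) (if k.+2 <= c then X else if c <= k then Y else 0) =
  minn m c.-1 * X + (m - c) * Y.
Proof.
elim: m => [|m IH]; first by rewrite big_ord0; lia.
rewrite big_ord_recr /= IH.
case: (leqP m.+2 c) => h1; last case: (leqP c m) => h2.
- have -> : minn m c.-1 = m by lia.
  have -> : minn m.+1 c.-1 = m.+1 by lia.
  have -> : m - c = m.+1 - c by lia.
  by lia.
- have -> : minn m c.-1 = c.-1 by lia.
  have -> : minn m.+1 c.-1 = c.-1 by lia.
  have -> : m.+1 - c = (m - c).+1 by lia.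
  by lia.
- have -> : minn m c.-1 = minn m.+1 c.-1 by lia.
  have -> : m - c = m.+1 - c by lia.
  by lia.
Qed.

Lemma bump_succ_eq k j c :
  ((bump k j).+1 == c) =
  if k.+2 <= c then j.+1 == c.-1 else if c <= k then j.+1 == c else false.
Proof.
by rewrite /bump; case: (leqP k.+2 c) => h1; last case: (leqP c k) => h2; lia.
Qed.

(* The new element goes either before z, which is then at position c - 1 among
   the old elements, or after z. For c = 0 all terms vanish, so truncated
   subtraction is harmless. *)
Lemma Nle_isolated (z : P) (c : nat) :
  Nle (Some z : isolated) c = c.-1 * Nle z c.-1 + (#|P|.+1 - c) * Nle z c.
Proof.
rewrite (NleE _ _ (esym card_isolated)) card_lexts_adjoin.
rewrite (eq_bigr (fun k : 'I_#|P|.+1 => if k.+2 <= c then Nle z c.-1 else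
    if c <= k then Nle z c else 0)); last first.
  move=> k _; rewrite !(NleE _ _ erefl).
  transitivity #|[set g in lexts P #|P| | (bump k (g z)).+1 == c]|.
    apply: eq_card => g; rewrite !inE ffunE /=; congr (_ && _).
    by rewrite (_ : [forall t, _] = true) //; apply/forallP.
  case: ifP => h1; last case: ifP => h2.
  - by apply: eq_card => g; rewrite !inE bump_succ_eq h1.
  - by apply: eq_card => g; rewrite !inE bump_succ_eq h1 h2.
  - apply/eqP; rewrite cards_eq0; apply/eqP/setP => g.
    by rewrite !inE bump_succ_eq h1 h2 andbF.
rewrite sum_insert_positions; congr (_ + _).
(* The minimum differs from [c.-1] only beyond the range of labels, where N(c - 1) = 0. *)
case: (leqP c.-1 #|P|.+1) => // lt_nc.
suff -> : Nle z c.-1 = 0 by rewrite !muln0.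
by apply/eqP; rewrite -leqn0 leqNgt; apply/negP => /Nle_gt0_bound; lia.
Qed.

End Isolated.

(** * The poset to which the conjecture is applied *)

Section CrossProductPoset.

Local Open Scope nat_scope.
Variables (d : Order.disp_t) (P : finPOrderType d).

Lemma upclosed_isSome : upclosed (isSome : pred (isolated P)).
Proof. by move=> [u|] [v|]. Qed.

Definition below_old : finPOrderType d := adjoin upclosed_isSome.

Definition cross_poset : finPOrderType d := adjoin (@upclosedT d below_old).

Definition cross_x : cross_poset := None.
Definition cross_y : cross_poset := Some None.
Definition cross_z (z : P) : cross_poset := Some (Some (Some z)).

Lemma card_below_old : #|below_old| = #|P|.+2.
Proof. by rewrite card_adjoin card_isolated. Qed.

Lemma card_cross_poset : #|cross_poset| = #|P|.+3.
Proof. by rewrite card_adjoin card_below_old. Qed.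

(** The bottom x has label 0, so the first difference forces y to position [k] once x is deleted.
    All of P then lies after y, so deleting y lowers the label of z by one. *)
Lemma Fle_cross (z : P) (k : 'I_#|P|.+2) (b : nat) :
  Fle cross_x cross_y (cross_z z) k.+1 b =
  #|[set h in lexts (isolated P) #|P|.+1 |
      [forall p : P, k <= h (Some p)] && ((h (Some z)).+1 == k + b)]|.
Proof.
rewrite (FleE _ _ _ _ _ (esym card_cross_poset)).
rewrite card_lexts_adjoin_bottom ?card_below_old //.
rewrite (eq_card (B := [set g in lexts below_old #|P|.+2 |
    (g None == k :> nat) && (g (Some (Some z)) == g None + b :> nat)]));
  last by move=> g; rewrite !inE !ffunE.
rewrite card_lexts_adjoin (bigD1 k) //= big1 ?addn0; last first.
  move=> j j_neq_k; apply/eqP; rewrite cards_eq0; apply/eqP/setP => h.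
  by rewrite in_set0 !inE !ffunE val_eqE (negPf j_neq_k) !andbF.
apply: eq_card => h; rewrite !inE; congr (_ && _); rewrite !ffunE eqxx /=.
have -> : [forall t : isolated P, isSome t ==> (k <= h t)] =
    [forall p : P, k <= h (Some p)].
  apply/forallP/forallP => [H p | H [p|] //=].
  exact: (H (Some p)).
case: forallP => //= /(_ z) k_le.
by rewrite /bump k_le add1n.
Qed.

Lemma Fle_cross1 (z : P) (b : nat) :
  Fle cross_x cross_y (cross_z z) 1 b = Nle (Some z : isolated P) b.
Proof.
rewrite (Fle_cross z ord0) (NleE _ _ (esym (card_isolated P))).
apply: eq_card => h; rewrite !inE; congr (_ && _).
by rewrite (_ : [forall p, _] = true) //; apply/forallP.
Qed.

Lemma Fle_cross2 (z : P) (b : nat) :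
  Fle cross_x cross_y (cross_z z) 2 b = Nle z b.
Proof.
rewrite (Fle_cross z (Ordinal (isT : 1 < #|P|.+2))) (NleE _ _ erefl).
rewrite card_lexts_adjoin (bigD1 ord0) //= big1 ?addn0.
  apply: eq_card => g; rewrite !inE; congr (_ && _); rewrite ffunE /= /bump /=.
  rewrite (_ : [forall t, _] = true); last by apply/forallP.
  rewrite (_ : [forall p, _] = true); last by apply/forallP => p; rewrite ffunE.
  by rewrite /= !add1n eqSS.
(* If u is not first, the first element of P keeps label 0, against the bound 1. *)
move=> k; rewrite -val_eqE /= => k_neq0.
apply/eqP; rewrite cards_eq0; apply/eqP/setP => g; rewrite in_set0.
apply/negP => /setIdP[g_lext /andP[_ /andP[/forallP ge1 _]]].
have n_gt0 : 0 < #|P| by apply/card_gt0P; exists z.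
have [p gp] := lexts_surj (Ordinal n_gt0) erefl g_lext.
by have := ge1 p; rewrite ffunE /= gp /bump /=; lia.
Qed.

End CrossProductPoset.

(** * Monotonicity of the ratio N'(c) / N(c) *)

Section RatioMonotone.

Local Open Scope nat_scope.
Hypothesis CPC : cross_product_conjecture.

Lemma ratio_step (d : Order.disp_t) (P : finPOrderType d) (z : P) (b : nat) :
  Nle (Some z : isolated P) b * Nle z b.+1 <=
  Nle (Some z : isolated P) b.+1 * Nle z b.
Proof.
(* The conjecture needs [b >= 1]; at 0 both sides vanish. *)
case: b => [|b]; first by rewrite !Nle0.
have := CPC (x := cross_x P) (y := cross_y P) (z := cross_z z)
  isT isT isT (a := 1%:Z) (b := b.+1%:Z) isT isT.
have -> : (1%:Z + 1 = 2%:Z)%R by [].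
have -> : (b.+1%:Z + 1 = b.+2%:Z)%R by lia.
by rewrite !Fle_cross1 !Fle_cross2 [X in _ <= X]mulnC.
Qed.

(* Adjoining an isolated element shortens a gap in the support by one. *)
Lemma Nle_no_gap (g : nat) (d : Order.disp_t) (P : finPOrderType d) (z : P)
    (c : nat) :
  0 < Nle z c -> 0 < Nle z (c + g).+1 -> 0 < Nle z c.+1.
Proof.
elim: g d P z c => [|g IH] d P z c N_c; first by rewrite addn0.
move=> N_end.
have /andP[c_gt0 _] := Nle_gt0_bound N_c.
have /andP[_ end_le] := Nle_gt0_bound N_end.
have N'_c1 : 0 < Nle (Some z : isolated P) c.+1.
  by rewrite Nle_isolated /= addn_gt0 muln_gt0 c_gt0 N_c.
(* The far end stays in the support of N', as its coefficient n + 1 - (c + g + 2) is positive, while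
   the near end has moved to c + 1. *)
have N'_c2 : 0 < Nle (Some z : isolated P) c.+2.
  apply: IH N'_c1 _; rewrite addSnnS Nle_isolated addn_gt0; apply/orP; right.
  by rewrite muln_gt0 N_end andbT; lia.
rewrite lt0n; apply/eqP => N_c1.
have N_c2 : 0 < Nle z c.+2.
  by move: N'_c2; rewrite Nle_isolated /= N_c1 muln0 add0n muln_gt0 => /andP[].
have := ratio_step z c.+1.
by rewrite N_c1 muln0 leqn0 muln_eq0 -leqn0 leqNgt N'_c1 -leqn0 leqNgt N_c2.
Qed.

(** Two consecutive ratio inequalities chain once N(a + 1) > 0 is cancelled. If N(a) = 0 < N(a + i),
    the absence of gaps gives (a - 1) N(a - 1) = 0, hence N'(a) = 0. *)
Lemma ratio_mono (d : Order.disp_t) (P : finPOrderType d) (z : P) (a i : nat) :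
  Nle (Some z : isolated P) a * Nle z (a + i)%N <=
  Nle (Some z : isolated P) (a + i)%N * Nle z a.
Proof.
elim: i a => [|i IH] a; first by rewrite addn0.
rewrite addnS; have [->|N_end] := posnP (Nle z (a + i).+1); first
  by rewrite muln0.
have [N_a|N_a] := posnP (Nle z a).
  rewrite N_a muln0 leqn0 muln_eq0 Nle_isolated N_a muln0 addn0 muln_eq0.
  case: a {IH} N_a N_end => [//|a] N_a N_end /=.
  have [_|N_a1] := posnP (Nle z a); first by rewrite orbT.
  have := @Nle_no_gap i.+1 _ _ _ _ N_a1; rewrite N_a addnS -addSn.
  by move/(_ N_end).
have N_a1 := Nle_no_gap N_a N_end.
have := IH a.+1; rewrite addSn => le2; have le1 := ratio_step z a.
rewrite -(leq_pmul2r N_a1) mulnAC.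
apply: leq_trans (leq_mul le1 (leqnn _)) _.
by rewrite mulnAC [X in _ <= X]mulnAC leq_mul2r le2 orbT.
Qed.

End RatioMonotone.

Theorem theorem10p5 (CPC : cross_product_conjecture)
    (d : Order.disp_t) (P : finPOrderType d) (z : P) (a i : int)
    (ha : 1 <= a) (hi : 1 <= i) :
  (a - 1) * (Nle z (a - 1))%:Z * (Nle z (a + i))%:Z
    + i * (Nle z (a + i))%:Z * (Nle z a)%:Z
  <= (a + i - 1) * (Nle z (a + i - 1))%:Z * (Nle z a)%:Z.
Proof.
case: a ha => [[//|a]|//] _; case: i hi => [[//|i]|//] _.
have -> : a.+1%:Z - 1 = a by lia.
have -> : a.+1%:Z + i.+1%:Z = (a.+1 + i.+1)%N by lia.
have -> : (a.+1 + i.+1)%N%:Z - 1 = (a + i.+1)%N by lia.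
have [->|N_end] := posnP (Nle z (a.+1 + i.+1)%N).
  by rewrite !mulr0 mul0r addr0 !mulr_ge0.
have /andP[_ end_le] := Nle_gt0_bound N_end.
have := ratio_mono CPC z a.+1 i.+1; rewrite !Nle_isolated /=.
rewrite -!PoszM -PoszD lez_nat.
set n := #|P| in end_le *; move: end_le {N_end}.
move: (Nle z a) (Nle z a.+1) (Nle z (a + i.+1)) (Nle z _) => p q r s end_le.
(* The two coefficients differ by [i.+1]; their common part cancels and leaves the last term of the
   claim. *)
have -> : (n.+1 - a.+1 = (n - (a + i.+1)) + i.+1)%N by lia.
have -> : (n.+1 - (a.+1 + i.+1) = n - (a + i.+1))%N by lia.
by nia.
Qed.
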